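(* Let $(M,L)$ be an $R_3$-like Finsler manifold. If $m_o(\overline{X})=t\,\phi(\overline{X})$ for all $\overline{X}\in\mathfrak{X}(\pi(M))$, for some scalar function $t$, then $(M,L)$ is a Finsler manifold of $s$-$ps$ curvature.
   Context: Setting. $M$ is a smooth manifold of finite dimension $n$, $\pi:\mathcal{T}M\to M$ is the bundle of nonzero tangent vectors, $\pi^{-1}(TM)\to\mathcal{T}M$ is the pullback of $TM$ by $\pi$, and $\mathfrak{X}(\pi(M))$ is the module of its smooth sections ($\pi$-vector fields, written $\overline{X}$). $\overline{\eta}(u)=(u,u)$ is the fundamental $\pi$-vector field. $\rho:T(\mathcal{T}M)\to\pi^{-1}(TM)$ is $\rho=(\pi_{\mathcal{T}M},d\pi)$ and $\gamma:\pi^{-1}(TM)\to V(\mathcal{T}M)$ is the natural isomorphism (vertical lift) onto the vertical bundle. $(M,L)$ is a Finsler manifold ($L$ positively homogeneous of degree $1$, smooth on $\mathcal{T}M$, with positive definite metric $g$ on $\pi^{-1}(TM)$ of components $g_{ij}=\frac12\partial^2L^2/\partial y^i\partial y^j$). Put $\ell(\overline{X})=L^{-1}g(\overline{X},\overline{\eta})$, $\hbar=g-\ell\otimes\ell$ and $\phi(\overline{X})=\overline{X}-L^{-1}\ell(\overline{X})\overline{\eta}$. A linear connection $\nabla$ in $\pi^{-1}(TM)$ is regular if, with $K(X)=\nabla_X\overline{\eta}$ and $H(\mathcal{T}M)=\ker K$, one has $T(\mathcal{T}M)=V(\mathcal{T}M)\oplus H(\mathcal{T}M)$; then $\beta=(\rho|_{H(\mathcal{T}M)})^{-1}$.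 Its torsion is $\mathbf{T}(X,Y)=\nabla_X\rho Y-\nabla_Y\rho X-\rho[X,Y]$; put $Q(\overline{X},\overline{Y})=\mathbf{T}(\beta\overline{X},\beta\overline{Y})$ and $T(\overline{X},\overline{Y})=\mathbf{T}(\gamma\overline{X},\beta\overline{Y})$. Throughout, $\nabla$ is the Cartan connection: the unique regular connection with $\nabla g=0$, $Q=0$ and $g(T(\overline{X},\overline{Y}),\overline{Z})=g(T(\overline{X},\overline{Z}),\overline{Y})$. Its classical curvature is $\mathbf{K}(X,Y)\rho Z=-\nabla_X\nabla_Y\rho Z+\nabla_Y\nabla_X\rho Z+\nabla_{[X,Y]}\rho Z$ and its $h$-curvature tensor is $R(\overline{X},\overline{Y})\overline{Z}=\mathbf{K}(\beta\overline{X},\beta\overline{Y})\overline{Z}$, with $R(\overline{X},\overline{Y},\overline{Z},\overline{W})=g(R(\overline{X},\overline{Y})\overline{Z},\overline{W})$. Put $Ric^h(\overline{X},\overline{Y})=\mathrm{Tr}\{\overline{Z}\mapsto R(\overline{X},\overline{Z})\overline{Y}\}$, $g(Ric^h_0(\overline{X}),\overline{Y})=Ric^h(\overline{X},\overline{Y})$, $Sc^h=\mathrm{Tr}(Ric^h_0)$, and $F=\frac{1}{n-2}\{Ric^h-\frac{Sc^h\,g}{2(n-1)}\}$. Let $m(\overline{X},\overline{Y})=F(\phi(\overline{X}),\phi(\overline{Y}))$ and define $m_o$ by $g(m_o(\overline{X}),\overline{Y})=m(\overline{X},\overline{Y})$. Definitions. $(M,L)$ is: - $R_3$-like if $\dim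 M\ge4$ and $R(\overline{X},\overline{Y},\overline{Z},\overline{W})=g(\overline{X},\overline{Z})F(\overline{Y},\overline{W})-g(\overline{Y},\overline{Z})F(\overline{X},\overline{W})+g(\overline{Y},\overline{W})F(\overline{X},\overline{Z})-g(\overline{X},\overline{W})F(\overline{Y},\overline{Z})$; - of scalar curvature ($\dim M\geq 3$) if $R(\overline{\eta},\overline{X},\overline{\eta},\overline{Y})=kL^2\hbar(\overline{X},\overline{Y})$ for some scalar function $k:\mathcal{T}M\to\mathbb{R}$; - of $p$-scalar curvature if there is a function $R_o$ with $R(\phi(\overline{X}),\phi(\overline{Y}),\phi(\overline{Z}),\phi(\overline{W}))=R_o\{\hbar(\overline{X},\overline{Z})\hbar(\overline{Y},\overline{W})-\hbar(\overline{X},\overline{W})\hbar(\overline{Y},\overline{Z})\}$; - of $s$-$ps$ curvature if it is both of scalar curvature and of $p$-scalar curvature. *)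

(* Defs.v *)
From mathcomp Require Import all_boot all_order all_algebra.
From mathcomp Require Import all_classical all_reals all_analysis.
Import numFieldNormedType.Exports.

Set Implicit Arguments.
Unset Strict Implicit.
Unset Printing Implicit Defensive.

Import Order.TTheory GRing.Theory Num.Theory.
Local Open Scope classical_set_scope.
Local Open Scope ring_scope.

(** * Calculus in R^d *)

Section Calculus.
Variables (R : realType) (V W : normedModType R).

Fixpoint Ck (k : nat) (A : set V) (f : V -> W) : Prop :=
  match k with
  | 0 => forall x, A x -> {for x, continuous f}
  | k'.+1 => (forall x, A x -> differentiable f x) /\
             (forall v : V, Ck k' A ('D_v f))
  end.

(** Meant for open [A]; nothing is asked of [f] outside [A]. *)
Definition smooth_on (A : set V) (f : V -> W) : Prop := forall k, Ck k A f.

End Calculus.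

(** * Atlases and tangent vectors *)

(** The tangent space at [x] of a space with an atlas of dimension [d] is
    ['rV[R]_d]: a tangent vector is given by its components in the chart
    [chart_at x], chosen once and for all at each point; [tcoord i x v] gives
    its components in any other chart [i] around [x]. *)
Record atlas (R : realType) (d : nat) (T : choiceType) := Atlas {
  cindex : Type;
  dom : cindex -> set T;
  chart : cindex -> T -> 'rV[R]_d;
  chart_at : T -> cindex }.

Section AtlasTheory.
Variables (R : realType) (d : nat) (T : choiceType) (A : atlas R d T).

(** The image in R^d of the domain of the chart [i]. *)
Definition cdom (i : cindex A) : set 'rV[R]_d := chart i @` dom i.

(** The inverse of the chart [i]; its value outside [cdom i] is the
    irrelevant default [x0]. *)
Definition cinv (i : cindex A) (x0 : T) (p : 'rV[R]_d) : T :=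
  xget x0 [set x | dom i x /\ chart i x = p].

Definition tcoord (i : cindex A) (x : T) (v : 'rV[R]_d) : 'rV[R]_d :=
  'd (fun p => chart i (cinv (chart_at A x) x p)) (chart (chart_at A x) x) v.

(** [h i x] is the expression in the chart [i] of some object at [x]: a
    number, or the components of a vector. *)
Definition smooth_in_charts (W : normedModType R) (h : cindex A -> T -> W) :=
  forall i, exists2 H : 'rV[R]_d -> W,
    smooth_on (cdom i) H & forall x, dom i x -> h i x = H (chart i x).

Definition smooth_fun (f : T -> R) : Prop :=
  @smooth_in_charts R^o (fun _ => f).

Definition smooth_vfield (X : T -> 'rV[R]_d) : Prop :=
  smooth_in_charts (fun i x => tcoord i x (X x)).

(** The derivative of the function [f] along the tangent vector [w] at [x]. *)
Definition dfun (f : T -> R) (x : T) (w : 'rV[R]_d) : R :=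
  'd (fun p => f (cinv (chart_at A x) x p) : R^o) (chart (chart_at A x) x) w.

(** The Lie bracket, computed at [x] in the chart [chart_at A x]. *)
Definition bracket (X Y : T -> 'rV[R]_d) (x : T) : 'rV[R]_d :=
  let i := chart_at A x in
  let p := chart i x in
  let rep (Z : T -> 'rV[R]_d) q :=
    tcoord i (cinv i x q) (Z (cinv i x q)) in
  'd (rep Y) p (rep X p) - 'd (rep X) p (rep Y p).

End AtlasTheory.

(** The tangent map of [f] at [x]. *)
Definition tmap (R : realType) (d e : nat) (T U : choiceType)
    (A : atlas R d T) (B : atlas R e U) (f : T -> U)
    (x : T) (w : 'rV[R]_d) : 'rV[R]_e :=
  'd (fun p => chart (chart_at B (f x)) (f (cinv (chart_at A x) x p)))
     (chart (chart_at A x) x) w.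

(** * Smooth manifolds and their nonzero tangent vectors *)

Record manifold (R : realType) (n : nat) := Manifold {
  carrier :> topologicalType;
  matlas : atlas R n carrier;
  manifold_hausdorff : hausdorff_space carrier;
  manifold_second_countable : @second_countable carrier;
  dom_open : forall i : cindex matlas, open (dom i);
  dom_chart_at : forall x : carrier, dom (chart_at matlas x) x;
  chart_inj : forall (i : cindex matlas) (x y : carrier),
    dom i x -> dom i y -> chart i x = chart i y -> x = y;
  chart_continuous : forall (i : cindex matlas) (x : carrier),
    dom i x -> {for x, continuous (chart i)};
  chart_open : forall (i : cindex matlas) (U : set carrier),
    open U -> U `<=` dom i -> open (chart i @` U);
  chart_compatible : forall i j : cindex matlas,
    exists2 F : 'rV[R]_n -> 'rV[R]_n,
      smooth_on (chart i @` (dom i `&` dom j)) F &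
      forall x, dom i x -> dom j x -> F (chart i x) = chart j x }.

Section PullbackBundle.
Variables (R : realType) (n : nat) (M : manifold R n).

(** [(x, y)] is the vector [y] of the tangent space at [x]. *)
Definition TM : Type := (carrier M * 'rV[R]_n)%type.

Definition slitTM : Type := {u : carrier M * 'rV[R]_n | u.2 != 0}.

Definition base (u : slitTM) : M := (val u).1.

Definition TM_chart (i : cindex (matlas M)) (u : TM) : 'rV[R]_(n + n) :=
  row_mx (chart i u.1) (tcoord i u.1 u.2).

Definition slit_atlas : atlas R (n + n) slitTM :=
  {| cindex := cindex (matlas M);
     dom := fun i => [set u | dom i (base u)];
     chart := fun i u => TM_chart i (val u);
     chart_at := fun u => chart_at (matlas M) (base u) |}.

Local Notation E := 'rV[R]_n.
Local Notation TT := 'rV[R]_(n + n).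

(** A π-vector field assigns to [u] a tangent vector at [base u]. *)
Definition pi_vfield : Type := slitTM -> E.

Definition smooth_section (Z : pi_vfield) : Prop :=
  @smooth_in_charts R (n + n) slitTM slit_atlas _
    (fun (i : cindex (matlas M)) u => tcoord i (base u) (Z u)).

Definition eta : pi_vfield := fun u => (val u).2.

(** The map ρ, from the tangent space at [u] to the fibre at [u]. *)
Definition rho (u : slitTM) (w : TT) : E :=
  tmap slit_atlas (matlas M) base u w.

(** The vertical lift γ: the velocity at 0 of t |-> u + t v. *)
Definition gamma (u : slitTM) (v : E) : TT :=
  'D_(1 : R^o) (fun t : R^o =>
    TM_chart (chart_at slit_atlas u) (base u, eta u + t *: v)) 0.

(** * Linear connections in the pullback bundle *)

(** [nabla u w Z] is the covariant derivative of [Z] along the tangent vector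
    [w] at [u]; its value on sections that are not smooth is irrelevant. *)
Record connection := Connection {
  nabla :> slitTM -> TT -> pi_vfield -> E;
  nabla_linear : forall u (Z : pi_vfield), smooth_section Z ->
    forall (a : R) (w w' : TT),
      nabla u (a *: w + w') Z = a *: nabla u w Z + nabla u w' Z;
  nabla_additive : forall u (w : TT) (Z Z' : pi_vfield),
    smooth_section Z -> smooth_section Z' ->
    nabla u w (fun v => Z v + Z' v) = nabla u w Z + nabla u w Z';
  nabla_leibniz : forall u (w : TT) (f : slitTM -> R) (Z : pi_vfield),
    smooth_fun slit_atlas f -> smooth_section Z ->
    nabla u w (fun v => f v *: Z v)
      = dfun slit_atlas f u w *: Z u + f u *: nabla u w Z;
  nabla_smooth : forall (X : slitTM -> TT) (Z : pi_vfield),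
    smooth_vfield slit_atlas X -> smooth_section Z ->
    smooth_section (fun u => nabla u (X u) Z) }.

Section Connection.
Variable D : connection.

Definition cov (X : slitTM -> TT) (Z : pi_vfield) : pi_vfield :=
  fun u => D u (X u) Z.

Definition Kmap (u : slitTM) (w : TT) : E := D u w eta.

Definition vertical (u : slitTM) : set TT := [set w | rho u w = 0].
Definition horizontal (u : slitTM) : set TT := [set w | Kmap u w = 0].

Definition regular : Prop := forall u,
  vertical u `&` horizontal u = [set 0] /\
  forall w, exists v h, [/\ vertical u v, horizontal u h & w = v + h].

(** The inverse of ρ on the horizontal space, for regular [D]. *)
Definition beta (u : slitTM) (x : E) : TT :=
  get [set w | horizontal u w /\ rho u w = x].

Definition hlift (X : pi_vfield) : slitTM -> TT := fun u => beta u (X u).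
Definition vlift (X : pi_vfield) : slitTM -> TT := fun u => gamma u (X u).
Definition rhof (X : slitTM -> TT) : pi_vfield := fun u => rho u (X u).

Definition torsion (X Y : slitTM -> TT) : pi_vfield := fun u =>
  cov X (rhof Y) u - cov Y (rhof X) u - rho u (bracket slit_atlas X Y u).

Definition Qtorsion (X Y : pi_vfield) : pi_vfield :=
  torsion (hlift X) (hlift Y).
Definition Ttorsion (X Y : pi_vfield) : pi_vfield :=
  torsion (vlift X) (hlift Y).

(** The classical curvature, applied to the π-vector field [Z] (that is, to
    ρ of any lift of [Z]). *)
Definition curvature (X Y : slitTM -> TT) (Z : pi_vfield) : pi_vfield :=
  fun u => - cov X (cov Y Z) u + cov Y (cov X Z) u
           + cov (bracket slit_atlas X Y) Z u.

(** Tensor fields are families of multilinear maps on the fibres; identities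
    between tensor fields are stated fibre by fibre. *)
Definition trilinear_field (Rh : slitTM -> E -> E -> E -> E) : Prop :=
  forall u, [/\ forall y z, linear (fun x => Rh u x y z),
                forall x z, linear (fun y => Rh u x y z) &
                forall x y, linear (fun z => Rh u x y z)].

(** [Rh] is the h-curvature tensor of [D]: the tensor field whose values on
    π-vector fields are given by the curvature of their horizontal lifts. *)
Definition is_h_curvature (Rh : slitTM -> E -> E -> E -> E) : Prop :=
  trilinear_field Rh /\
  forall X Y Z : pi_vfield,
    smooth_section X -> smooth_section Y -> smooth_section Z ->
    forall u, Rh u (X u) (Y u) (Z u) = curvature (hlift X) (hlift Y) Z u.

End Connection.

(** * Finsler structures and the Cartan connection *)

Section Finsler.
Variable L : TM -> R.

Definition Lslit (u : slitTM) : R := L (val u).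

(** The components of [metric] in the basis of the fibre are
    1/2 d^2(L^2)/dy^i dy^j. *)
Definition metric (u : slitTM) (v w : E) : R :=
  2^-1 * 'D_v ('D_w (fun y : E => L (base u, y) ^+ 2 : R^o)) (eta u).

Definition finsler : Prop :=
  [/\ smooth_fun slit_atlas Lslit,
      forall (x : M) (y : E) (a : R), 0 < a -> L (x, a *: y) = a * L (x, y) &
      forall u v, v != 0 -> 0 < metric u v v].

Definition cartan (D : connection) : Prop :=
  [/\ regular D,
      forall (Y Z : pi_vfield), smooth_section Y -> smooth_section Z ->
        forall u w, dfun slit_atlas (fun v => metric v (Y v) (Z v)) u w
                    = metric u (D u w Y) (Z u) + metric u (Y u) (D u w Z),
      forall X Y : pi_vfield, smooth_section X -> smooth_section Y ->
        forall u, Qtorsion D X Y u = 0 &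
      forall X Y Z : pi_vfield,
        smooth_section X -> smooth_section Y -> smooth_section Z ->
        forall u, metric u (Ttorsion D X Y u) (Z u)
                  = metric u (Ttorsion D X Z u) (Y u)].

Definition ell (u : slitTM) (x : E) : R :=
  (Lslit u)^-1 * metric u x (eta u).

Definition hbar (u : slitTM) (x y : E) : R :=
  metric u x y - ell u x * ell u y.

Definition phi (u : slitTM) (x : E) : E :=
  x - ((Lslit u)^-1 * ell u x) *: eta u.

(** The π-endomorphism [B_o] with g(B_o(x), y) = B(x, y). *)
Definition raise (B : slitTM -> E -> E -> R) (u : slitTM) (x : E) : E :=
  get [set v | forall y, metric u v y = B u x y].

Definition endo_trace (f : E -> E) : R := \tr (lin1_mx f).

Section Curvature.
Variable Rh : slitTM -> E -> E -> E -> E.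

Definition Rh4 (u : slitTM) (x y z w : E) : R := metric u (Rh u x y z) w.

Definition Ric (u : slitTM) (x y : E) : R := endo_trace (fun z => Rh u x z y).

Definition Sc (u : slitTM) : R := endo_trace (raise Ric u).

Definition Ften (u : slitTM) (x y : E) : R :=
  (n%:R - 2)^-1 * (Ric u x y - Sc u * metric u x y / (2 * (n%:R - 1))).

Definition mten (u : slitTM) (x y : E) : R := Ften u (phi u x) (phi u y).

Definition R3_like : Prop :=
  (4 <= n)%N /\
  forall u x y z w,
    Rh4 u x y z w = metric u x z * Ften u y w - metric u y z * Ften u x w
                  + metric u y w * Ften u x z - metric u x w * Ften u y z.

Definition scalar_curvature : Prop :=
  (3 <= n)%N /\
  exists k : slitTM -> R, forall u x y,
    Rh4 u (eta u) x (eta u) y = k u * Lslit u ^+ 2 * hbar u x y.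

Definition p_scalar_curvature : Prop :=
  exists Ro : slitTM -> R, forall u x y z w,
    Rh4 u (phi u x) (phi u y) (phi u z) (phi u w)
    = Ro u * (hbar u x z * hbar u y w - hbar u x w * hbar u y z).

Definition s_ps_curvature : Prop :=
  scalar_curvature /\ p_scalar_curvature.

End Curvature.
End Finsler.
End PullbackBundle.

(* Main.v *)
From HB Require Import structures.
Require Import Defs.
From mathcomp Require Import all_boot all_order all_algebra.
From mathcomp Require Import all_classical all_reals all_analysis.
From mathcomp Require Import ring.
Import numFieldNormedType.Exports.

Set Implicit Arguments.
Unset Strict Implicit.
Unset Printing Implicit Defensive.

Import Order.TTheory GRing.Theory Num.Theory.
Local Open Scope classical_set_scope.
Local Open Scope ring_scope.

(** Fix a nonzero tangent vector u and write g, F, l for the metric, the tensor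
    of the R_3-like condition and L at u. Two facts about g do all the work:
    it is bilinear and nondegenerate, and it is symmetric against eta with
    g(eta, eta) = l^2. Hence phi is the projection along eta, with
    g(phi x, phi y) = hbar(x, y) (lemma [metric_phi]).

    The hypothesis on m_o says F(phi x, phi y) = t hbar(x, y). Substituting
    phi x, phi y, phi z, phi w in the R_3-like formula turns every g into hbar
    and every F into t hbar, which is p-scalar curvature with R_o = 2 t.

    For scalar curvature, write x = phi x + a eta and y = phi y + b eta with
    a = g(x, eta) / l^2 and b = g(y, eta) / l^2. In the R_3-like formula for
    R(eta, x, eta, y) the terms in F(phi x, eta) and F(eta, phi y) cancel and
    l^2 F(phi x, phi y) + hbar(x, y) F(eta, eta) is left, so that
    k = t + F(eta, eta) / l^2.

    The facts about g come from calculus. In the chart at the base point x the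
    energy q = L^2, restricted to the tangent space at x, is the square of a
    smooth function precomposed with an affine map, so q and its first
    derivatives are differentiable off the origin ([fibre_energy_smooth]); this
    makes g(v, w) = D_v D_w q / 2 bilinear. As q is positively homogeneous of
    degree 2 and D_w q of degree 1, the Euler identity gives
    g(eta, w) = D_w q / 2 and g(eta, eta) = q. The symmetry
    g(v, eta) = g(eta, v) also comes from the Euler identity
    ([derive_radial_derive]), in the place of a theorem on the equality of mixed
    second derivatives. *)

(** * Differentials of functions that agree near a point *)

Section LocalDifferentials.
Variables (R : realType) (V W : normedModType R).
Implicit Types (f g : V -> W) (x y v w : V).

Lemma near_neq0 y : y != 0 -> \forall z \near y, z != 0.
Proof. by move=> y0; exact: (@cvgr_neq0 _ _ _ _ _ id y cvg_id y0). Qed.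

Lemma near_line x v (P : set V) :
  (\forall y \near x, P y) -> \forall h \near (0 : R)^', P (h *: v + x).
Proof.
move=> Px; apply: cvg_within.
have : (h : R) *: v + x @[h --> 0] --> x.
  rewrite -[X in _ --> X]add0r -[X in _ --> X + _](scale0r v).
  by apply: cvgD; [apply: cvgZr_tmp; exact: cvg_id|exact: cvg_cst].
by apply.
Qed.

(** The differential depends only on the germ of the function: the remainder
    estimate characterizing it is local. *)
Lemma near_eq_is_diff f g x (df : V -> W) :
  (\forall y \near x, f y = g y) -> is_diff x f df -> is_diff x g df.
Proof.
move=> fg [dfx dfE].
have gE : g \o shift x = cst (g x) + 'd f x +o_ (0 : V) id.
  have [_ fE] := (diff_locallyP _ _).1 dfx.
  apply/eqaddoP => e e0.
  have {fE} /eqaddoP/(_ e e0) fE := fE.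
  have fg0 : \forall h \near (0 : V), f (h + x) = g (h + x).
    have := fg; rewrite (near_shift 0 x); apply: filterS => h /=.
    by rewrite subr0.
  have fgx : f x = g x := nbhs_singleton fg.
  near=> h.
  have : `|(f \o shift x - (cst (f x) + 'd f x)) h| <= e * `|id h| by near: h.
  have fgh : f (h + x) = g (h + x) by near: h.
  suff -> : (f \o shift x - (cst (f x) + 'd f x)) h =
            (g \o shift x - (cst (g x) + 'd f x)) h by [].
  by rewrite !fctE /= fgh fgx.
have dc : continuous ('d f x) := diff_continuous dfx.
have dg := diff_unique dc gE.
apply: DiffDef; last by rewrite dg.
by apply/diff_locallyP; rewrite dg.
Unshelve. all: by end_near. Qed.

Lemma near_eq_differentiable f g x :
  (\forall y \near x, f y = g y) -> differentiable f x -> differentiable g x.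
Proof. by move=> fg /differentiableP /(near_eq_is_diff fg) []. Qed.

Lemma differentiable_derive_linear f x : differentiable f x ->
  forall a v w, 'D_(a *: v + w) f x = a *: 'D_v f x + 'D_w f x.
Proof. by move=> df a v w; rewrite !deriveE// linearP. Qed.

End LocalDifferentials.

(** * Positively homogeneous functions *)

Section Homogeneous.
Variables (R : realType) (V : normedModType R).
Implicit Types (f q : V -> R^o) (y v w : V).

Definition homogeneous k f :=
  forall a y, 0 < a -> y != 0 -> f (a *: y) = a ^+ k * f y.

(** Along the ray through [y] the difference quotients of [f] are those of
    a |-> a^k f(y) at a = 1. *)
Lemma euler_homogeneous k f y :
  homogeneous k f -> y != 0 -> 'D_y f y = k%:R * f y.
Proof.
move=> fk y0.
have -> : 'D_y f y = 'D_(1 : R^o) (fun a : R^o => a ^+ k * f y : R^o) 1.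
  have gt0 : \forall h \near (0 : R)^', 0 < h + 1.
    apply: cvg_within; have := @lt_nbhsr R (-1) 0 (ltrN10 _).
    by apply: filterS => h; rewrite -[X in _ -> _ < _ + X]opprK subr_gt0.
  have quotE : \forall h \near (0 : R)^',
      h^-1 *: ((f \o shift y) (h *: y) - f y)
      = h^-1 *: (((fun a : R^o => a ^+ k * f y : R^o) \o shift 1) (h *: 1)
                 - 1 ^+ k * f y).
    near=> h; have h0 : 0 < h + 1 by near: h.
    rewrite /= /shift -[X in h *: y + X]scale1r -scalerDl fk// expr1n mul1r.
    by rewrite /GRing.scale/= mulr1.
  rewrite /derive; congr (lim _); apply/seteqP; split; apply: near_eq_cvg => //.
  by apply: filterS quotE => h ->.
have -> : (fun a : R^o => a ^+ k * f y : R^o) = f y \*: (@GRing.exp R ^~ k).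
  by apply/funext => a /=; rewrite mulrC.
rewrite deriveZ ?exp_derive /=; last exact: exprn_derivable.
by rewrite expr1n /GRing.scale/= !mulr1 mulrC.
Unshelve. all: by end_near. Qed.

(** The derivative at [y] along [w] of x |-> f(a x) is D_(a w) f (a y) by
    substitution in the quotient, and a^(k+1) D_w f (y) by homogeneity. *)
Lemma derive_homogeneous k f w :
    (forall y, y != 0 -> differentiable f y) ->
  homogeneous k.+1 f -> homogeneous k ('D_w f).
Proof.
move=> df fk a y a0 y0.
have ay0 : a *: y != 0 by rewrite scaler_eq0 negb_or gt_eqF.
have aN0 : a != 0 by rewrite gt_eqF.
suff E : a * 'D_w f (a *: y) = a ^+ k.+1 * 'D_w f y.
  by apply: (mulfI aN0); rewrite E exprS mulrA.
have -> : a * 'D_w f (a *: y) = 'D_(a *: w) f (a *: y).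
  by have d := df _ ay0; rewrite !deriveE// linearZ.
have -> : 'D_(a *: w) f (a *: y) = 'D_w (fun x => f (a *: x) : R^o) y.
  rewrite /derive; set g := (fun h : R => _); set g' := (fun h : R => _).
  suff -> : g = g' by [].
  by apply/funext => h; rewrite /g /g' /= (scalerDr a) !scalerA (mulrC a).
rewrite (@near_eq_derive _ _ _ _ (a ^+ k.+1 \*: f)).
  by rewrite deriveZ//; exact: diff_derivable (df _ y0).
by apply: filterS (near_neq0 y0) => x x0; rewrite fk.
Qed.

(** A mixed second derivative where one direction is radial. At x = y + h z,
    the Euler identity gives
    D_y f (x) = D_x f (x) - h D_z f (x) = (k + 1) f(x) - h D_z f (x),
    and the derivative at h = 0 of the right-hand side is k D_z f (y) as soon as
    D_z f is continuous at [y]. *)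
Lemma derive_radial_derive k f y z :
    (forall x, x != 0 -> differentiable f x) -> {for y, continuous ('D_z f)} ->
  homogeneous k.+1 f -> y != 0 -> 'D_z ('D_y f) y = k%:R * 'D_z f y.
Proof.
move=> df cf fk y0.
have radial x h : x = h *: z + y -> x != 0 ->
    'D_y f x = k.+1%:R * f x - h * 'D_z f x.
  move=> xE x0; have d := df _ x0.
  rewrite -(euler_homogeneous fk x0) !deriveE//.
  have -> : y = x - h *: z by rewrite xE addrAC subrr add0r.
  by rewrite linearB linearZ.
have quotE : \forall h \near (0 : R)^',
    h^-1 *: (('D_y f \o shift y) (h *: z) - 'D_y f y)
    = k.+1%:R * (h^-1 *: ((f \o shift y) (h *: z) - f y))
      - 'D_z f (h *: z + y).
  have zy0 := near_line z (near_neq0 y0).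
  have h0 := nbhs_dnbhs_neq (0 : R).
  near=> h.
  rewrite /= /shift (radial (h *: z + y) h) //; last by near: h.
  rewrite (radial y 0) ?scale0r ?add0r// mul0r subr0 /GRing.scale/=.
  have hN0 : h != 0 by near: h.
  by field.
suff cvgq : h^-1 *: (('D_y f \o shift y) (h *: z) - 'D_y f y)
    @[h --> (0 : R)^'] --> (k%:R * 'D_z f y : R^o) by exact: cvg_lim cvgq.
have -> : k%:R * 'D_z f y = k.+1%:R * 'D_z f y - 'D_z f y.
  by rewrite -addn1 natrD mulrDl mul1r addrK.
apply: cvg_trans; first by apply: near_eq_cvg; apply: filterS quotE => h ->.
apply: cvgB.
  apply: cvgMl_tmp; exact: diff_derivable (df _ y0).
by move=> P nP; exact: near_line (cf P nP).
Unshelve. all: by end_near. Qed.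

End Homogeneous.

(** * Smoothness of the energy on the fibres *)

Section SmoothFibre.
Variables (R : realType) (n : nat).
Implicit Types (p y w : 'rV[R]_n) (H : 'rV[R]_(n + n) -> R^o).

Lemma differentiable_row_mx p y :
  differentiable (row_mx p : 'rV[R]_n -> 'rV[R]_(n + n)) y.
Proof.
pose f : 'rV[R]_n -> 'rV[R]_(n + n) := mulmxr (row_mx 0 1%:M).
have fE w : f w = row_mx 0 w by rewrite /f /= mul_mx_row mulmx0 mulmx1.
have cf : continuous f.
  move=> v A /nbhs_ballP[e /= e0 eA]; apply/nbhs_ballP.
  exists e => //= w [_ vw]; apply: eA; split=> // i j; rewrite !fE !mxE.
  by case: (fintype.split j) => k; [rewrite !mxE; exact: ballxx|exact: vw].
have -> : row_mx p = cst (row_mx p 0) + f.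
  by apply/funext => w; rewrite addrfctE /cst fE add_row_mx addr0 add0r.
apply: differentiableD; first exact: differentiable_cst.
exact: linear_differentiable.
Qed.

Lemma derive_comp_row_mx H p w :
  'D_w (fun y => H (row_mx p y) : R^o)
  = fun y => 'D_(row_mx 0 w) H (row_mx p y).
Proof.
apply/funext => y; rewrite /derive; set g := (fun h : R => _).
set g' := (fun h : R => _); suff -> : g = g' by [].
apply/funext => h; rewrite /g /g' /= /shift.
by rewrite (scale_row_mx h) scaler0 add_row_mx add0r.
Qed.

Lemma smooth_sqr_fibre H p :
    (forall y, y != 0 -> differentiable H (row_mx p y)) ->
    (forall v y, y != 0 -> differentiable ('D_v H : _ -> R^o) (row_mx p y)) ->
  forall q : 'rV[R]_n -> R^o,
    (forall y, y != 0 -> q y = H (row_mx p y) ^+ 2) ->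
  (forall y, y != 0 -> differentiable q y) /\
  (forall w y, y != 0 -> differentiable ('D_w q : _ -> R^o) y).
Proof.
move=> dH ddH q qE; pose G y : R^o := H (row_mx p y).
have dG y : y != 0 -> differentiable G y.
  move=> y0; apply: (@differentiable_comp _ _ _ _ (row_mx p) H).
    exact: differentiable_row_mx.
  exact: dH.
have ddG w y : y != 0 -> differentiable ('D_w G : _ -> R^o) y.
  move=> y0; rewrite derive_comp_row_mx.
  apply: (@differentiable_comp _ _ _ _ (row_mx p) ('D_(row_mx 0 w) H)).
    exact: differentiable_row_mx.
  exact: ddH.
have nearG y : y != 0 -> \forall z \near y, (G * G : _ -> R^o) z = q z.
  by move=> /near_neq0; apply: filterS => z z0; rewrite qE.
split=> [y y0|w y y0].
  apply: near_eq_differentiable (nearG _ y0) _.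
  by apply: differentiableM; exact: dG.
(* The Leibniz rule for G^2, valid near [y] but not at the origin. *)
pose dq : 'rV[R]_n -> R^o := G * 'D_w G + G * 'D_w G.
apply: (@near_eq_differentiable _ _ _ dq); last first.
  by apply: differentiableD; apply: differentiableM; (exact: dG || exact: ddG).
apply: filterS (near_neq0 y0) => z z0.
rewrite -(near_eq_derive w (nearG _ z0)) deriveM//.
all: exact: diff_derivable (dG _ z0).
Qed.

End SmoothFibre.

Section Charts.
Variables (R : realType) (n : nat) (M : manifold R n).

(** The image of a chart domain is open, so that [cinv] is a genuine inverse
    on a whole neighbourhood. *)
Lemma chart_cinv_near (i : cindex (matlas M)) (x x0 : M) : dom i x ->
  \forall p \near chart i x, chart i (cinv i x0 p) = p.
Proof.
move=> ix; have op : open (chart i @` dom i).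
  by apply: chart_open => //; exact: dom_open.
have : nbhs (chart i x) (chart i @` dom i).
  by apply: open_nbhs_nbhs; split=> //; exists x.
apply: filterS => _ [z iz <-]; rewrite /cinv.
by case: xgetP => [z' _ []//|/(_ z)]; case.
Qed.

(** The change of coordinates from the preferred chart to itself is the
    differential of a map that is the identity near the point. *)
Lemma tcoord_chart_at (x : M) (v : 'rV[R]_n) :
  tcoord (chart_at (matlas M) x) x v = v.
Proof.
set i := chart_at _ _; rewrite /tcoord -/i.
have ix : dom i x by exact: dom_chart_at.
have H : \forall p \near chart i x, id p = chart i (cinv i x p).
  by apply: filterS (chart_cinv_near x ix) => p ->.
by have [_ ->] := near_eq_is_diff H (is_diff_id (chart i x)).
Qed.

Section Fibre.
Variables (L : TM M -> R) (L_smooth : smooth_fun (slit_atlas M) (Lslit L)).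

Lemma fibre_energy_smooth (x : M) (q := fun y => L (x, y) ^+ 2 : R^o) :
  (forall y, y != 0 -> differentiable q y) /\
  (forall w y, y != 0 -> differentiable ('D_w q : _ -> R^o) y).
Proof.
pose i := chart_at (matlas M) x; have [H sH LH] := L_smooth i.
have slitE y (y0 : y != 0) :
    let u : slitTM M := exist _ (x, y) y0 in
    dom (i : cindex (slit_atlas M)) u /\
    chart (i : cindex (slit_atlas M)) u = row_mx (chart i x) y.
  by split; [exact: dom_chart_at|rewrite /= /TM_chart tcoord_chart_at].
have cdomP y : y != 0 ->
    cdom (i : cindex (slit_atlas M)) (row_mx (chart i x) y).
  by move=> y0; have [d <-] := slitE y y0; exists (exist _ (x, y) y0).
have [dH ddH] := sH 2%N.
apply: (@smooth_sqr_fibre _ _ H (chart i x)).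
- by move=> y /cdomP /dH.
- by move=> w y /cdomP; have [+ _] := ddH w; apply.
- by move=> y y0; have [d <-] := slitE y y0; rewrite -LH.
Qed.

End Fibre.
End Charts.

(** * The Finsler metric on a fibre *)

Section FinslerMetric.
Variables (R : realType) (n : nat) (M : manifold R n).
Variables (L : TM M -> R) (L_finsler : finsler L).
Implicit Types (u : slitTM M) (v w x y z : 'rV[R]_n).

Let energy u y : R^o := L (base u, y) ^+ 2.

Let eta_neq0 u : eta u != 0. Proof. exact: valP u. Qed.

Let energy_smooth u :
  (forall y, y != 0 -> differentiable (energy u) y) /\
  (forall w y, y != 0 -> differentiable ('D_w (energy u) : _ -> R^o) y).
Proof. by case: L_finsler => sL _ _; exact: fibre_energy_smooth. Qed.

Let energy_homogeneous u : homogeneous 2 (energy u).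
Proof.
by case: L_finsler => _ hL _ a y a0 _; rewrite /energy hL// exprMn.
Qed.

(** The left argument is the direction in which the differentiable function
    [D_w q] is differentiated. *)
Lemma metric_linear_l u w : scalar (metric L u ^~ w).
Proof.
move=> a v v'; have [_ d2] := energy_smooth u.
rewrite /metric (differentiable_derive_linear (d2 w _ (eta_neq0 u))).
by rewrite mulrDr /GRing.scale/= mulrCA.
Qed.

(** The inner derivative is linear in [w] at every nonzero vector, hence near
    [eta u], which is all that the outer derivative sees. *)
Lemma metric_linear_r u v : scalar (metric L u v).
Proof.
move=> a w w'; have [d1 d2] := energy_smooth u.
have e0 := eta_neq0 u.
rewrite /metric -/(energy u).
rewrite (@near_eq_derive _ _ _ _
  (a \*: ('D_w (energy u) : _ -> R^o) + 'D_w' (energy u))); last first.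
  apply: filterS (near_neq0 e0) => y y0.
  by rewrite (differentiable_derive_linear (d1 y y0)).
have dd t : derivable ('D_t (energy u) : _ -> R^o) (eta u) v.
  by apply: diff_derivable; exact: d2.
rewrite deriveD//; last exact: derivableZ.
by rewrite deriveZ// mulrDr /GRing.scale/= mulrCA.
Qed.

Lemma metric_eta_l u w : metric L u (eta u) w = 2^-1 * 'D_w (energy u) (eta u).
Proof.
have [d1 d2] := energy_smooth u.
rewrite /metric -/(energy u) (@euler_homogeneous _ _ 1) ?mul1r//.
exact: derive_homogeneous.
Qed.

Lemma metric_eta_r u v : metric L u v (eta u) = metric L u (eta u) v.
Proof.
have [d1 d2] := energy_smooth u; rewrite metric_eta_l /metric -/(energy u).
rewrite (@derive_radial_derive _ _ 1) ?mul1r//.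
by apply: differentiable_continuous; exact: d2.
Qed.

Lemma metric_eta_eta u : metric L u (eta u) (eta u) = Lslit L u ^+ 2.
Proof.
rewrite metric_eta_l (@euler_homogeneous _ _ 2)// mulKf ?pnatr_eq0//.
by rewrite /energy /Lslit /eta /base -surjective_pairing.
Qed.

Lemma metric_gt0 u v : v != 0 -> 0 < metric L u v v.
Proof. by case: L_finsler => _ _; apply. Qed.

Lemma Lslit_neq0 u : Lslit L u != 0.
Proof.
have := metric_gt0 u (eta_neq0 u); rewrite metric_eta_eta.
by apply: contraTneq => ->; rewrite expr0n ltxx.
Qed.

(** The Gram matrix of the metric is invertible because the metric is definite,
    so every linear form is represented by a vector and the choice in [raise] is
    made in a nonempty set. *)
Lemma raiseP (B : slitTM M -> 'rV[R]_n -> 'rV[R]_n -> R) u x y :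
  scalar (B u x) -> metric L u (raise L B u x) y = B u x y.
Proof.
move=> Blin.
have exp_row (f : 'rV[R]_n -> R) : scalar f ->
    forall w, f w = \sum_j w 0 j * f (delta_mx 0 j).
  move=> flin w; rewrite {1}(row_sum_delta w).
  pose fM := GRing.isLinear.Build _ _ _ _ f flin.
  pose fL : {linear 'rV[R]_n -> R^o} := HB.pack f fM.
  rewrite -[LHS]/(fL _) linear_sum; apply: eq_bigr => j _.
  by rewrite linearZ.
pose G : 'M[R]_n := \matrix_(i, j) metric L u (delta_mx 0 i) (delta_mx 0 j).
have GE v w : metric L u v w = \sum_j w 0 j * (v *m G) 0 j.
  rewrite (exp_row _ (metric_linear_r u v)); apply: eq_bigr => j _.
  congr (_ * _).
  rewrite (exp_row _ (metric_linear_l u _)) mxE; apply: eq_bigr => i _.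
  by rewrite mxE.
have Gunit : G \in unitmx.
  rewrite -row_free_unit; apply: inj_row_free => v vG0.
  apply/eqP; apply: contraT => /(metric_gt0 u).
  by rewrite GE vG0 big1 ?ltxx// => j _; rewrite mxE mulr0.
pose b : 'rV[R]_n := \row_j B u x (delta_mx 0 j).
have rep : exists v, forall y, metric L u v y = B u x y.
  exists (b *m invmx G) => z; rewrite GE mulmxKV// (exp_row _ Blin z).
  by apply: eq_bigr => j _; rewrite mxE.
exact: (getPex rep).
Qed.

End FinslerMetric.

(** * The projection along the fundamental vector field *)

Lemma scalar_subZ (R : pzRingType) (V : lmodType R) (f : V -> R) :
  scalar f -> forall x c z, f (x - c *: z) = f x - c * f z.
Proof. by move=> flin x c z; rewrite addrC -scaleNr flin mulNr addrC. Qed.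

Section Projection.
Variables (R : realType) (n : nat) (M : manifold R n).
Variables (L : TM M -> R) (L_finsler : finsler L).
Implicit Types (u : slitTM M) (x y z w : 'rV[R]_n).

Lemma phiE u x :
  phi L u x = x - (metric L u x (eta u) / Lslit L u ^+ 2) *: eta u.
Proof. by rewrite /phi /ell mulrA -expr2 exprVn [X in X *: _]mulrC. Qed.

Lemma hbarE u x y :
  hbar L u x y = metric L u x y
    - metric L u x (eta u) * metric L u y (eta u) / Lslit L u ^+ 2.
Proof.
rewrite /hbar /ell; congr (_ - _).
by rewrite [LHS]mulrACA -expr2 exprVn [LHS]mulrC.
Qed.

Lemma metric_scale_l u c x y : metric L u (c *: x) y = c * metric L u x y.
Proof.
have := metric_linear_l L_finsler u y c x 0; rewrite addr0 => ->.
have := metric_linear_l L_finsler u y (-1) 0 0.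
by rewrite scaler0 addr0 mulN1r addNr => ->; rewrite addr0.
Qed.

Lemma metric_subZ_l u x c z y :
  metric L u (x - c *: z) y = metric L u x y - c * metric L u z y.
Proof. exact: scalar_subZ (metric_linear_l L_finsler u y) x c z. Qed.

Lemma metric_subZ_r u x c z y :
  metric L u y (x - c *: z) = metric L u y x - c * metric L u y z.
Proof. exact: scalar_subZ (metric_linear_r L_finsler u y) x c z. Qed.

Lemma metric_phi_l u x y : metric L u (phi L u x) y = hbar L u x y.
Proof.
rewrite phiE hbarE metric_subZ_l -(metric_eta_r L_finsler u y).
by rewrite [in RHS]mulrAC.
Qed.

Lemma metric_phi u x y : metric L u (phi L u x) (phi L u y) = hbar L u x y.
Proof.
have L0 := Lslit_neq0 L_finsler u.
rewrite (phiE u y) metric_subZ_r !metric_phi_l [X in _ - _ * X]hbarE.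
by rewrite (metric_eta_eta L_finsler) mulfK ?expf_neq0// subrr mulr0 subr0.
Qed.

End Projection.

(** * Bilinearity of the Ricci-type tensors *)

Section RicciLinear.
Variables (R : realType) (n : nat) (M : manifold R n) (L : TM M -> R).
Variables (L_finsler : finsler L).
Variable Rh : slitTM M -> 'rV[R]_n -> 'rV[R]_n -> 'rV[R]_n -> 'rV[R]_n.
Hypothesis Rh_tri : trilinear_field Rh.
Implicit Types (u : slitTM M) (x y z w : 'rV[R]_n).

Let Ric_linear_l u y : scalar (Ric Rh u ^~ y).
Proof.
have [lx _ _] := Rh_tri u.
move=> a x x'; rewrite /Ric /endo_trace -linearP; congr (\tr _).
by apply/matrixP => i j; rewrite !mxE lx !mxE.
Qed.

Let Ric_linear_r u x : scalar (Ric Rh u x).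
Proof.
have [_ _ lz] := Rh_tri u.
move=> a y y'; rewrite /Ric /endo_trace -linearP; congr (\tr _).
by apply/matrixP => i j; rewrite !mxE lz !mxE.
Qed.

Lemma Ften_linear_l u y : scalar (Ften L Rh u ^~ y).
Proof.
move=> a x x'; rewrite /Ften Ric_linear_l (metric_linear_l L_finsler).
rewrite /GRing.scale/=; move: (Sc _ _ _) (_^-1) (_^-1) => s c d.
move: (Ric _ _ _ _) (Ric _ _ _ _) (metric _ _ _ _) (metric _ _ _ _).
by move=> ? ? ? ?; ring.
Qed.

Lemma Ften_linear_r u x : scalar (Ften L Rh u x).
Proof.
move=> a y y'; rewrite /Ften Ric_linear_r (metric_linear_r L_finsler).
rewrite /GRing.scale/=; move: (Sc _ _ _) (_^-1) (_^-1) => s c d.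
move: (Ric _ _ _ _) (Ric _ _ _ _) (metric _ _ _ _) (metric _ _ _ _).
by move=> ? ? ? ?; ring.
Qed.

Lemma Ften_subZ_l u x c z y :
  Ften L Rh u (x - c *: z) y = Ften L Rh u x y - c * Ften L Rh u z y.
Proof. exact: scalar_subZ (Ften_linear_l u y) x c z. Qed.

Lemma Ften_subZ_r u x c z y :
  Ften L Rh u y (x - c *: z) = Ften L Rh u y x - c * Ften L Rh u y z.
Proof. exact: scalar_subZ (Ften_linear_r u y) x c z. Qed.

Lemma phi_linear u : linear (phi L u).
Proof.
move=> a x y; rewrite !phiE (metric_linear_l L_finsler).
by rewrite mulrDl scalerDl scalerBr scalerA opprD addrACA [in RHS]mulrA.
Qed.

Lemma mten_linear_r u x : scalar (mten L Rh u x).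
Proof. by move=> a y z; rewrite /mten phi_linear Ften_linear_r. Qed.

End RicciLinear.

(** * Curvature of R_3-like manifolds *)

Theorem proposition3p52 (R : realType) (n : nat) (M : manifold R n)
    (L : TM M -> R) (D : connection M)
    (Rh : slitTM M -> 'rV[R]_n -> 'rV[R]_n -> 'rV[R]_n -> 'rV[R]_n)
    (L_finsler : finsler L) (D_cartan : cartan L D)
    (Rh_curvature : is_h_curvature D Rh)
    (R3 : R3_like L Rh)
    (t : slitTM M -> R)
    (m_o_phi : forall (u : slitTM M) (x : 'rV[R]_n),
       raise L (mten L Rh) u x = (t u *: phi L u x)%R) :
  s_ps_curvature L Rh.
Proof.
have [Rh_tri _] := Rh_curvature; have [n4 RE] := R3.
have mE u x y : Ften L Rh u (phi L u x) (phi L u y) = t u * hbar L u x y.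
  (* Both sides are the pairing of m_o x with y. *)
  rewrite -[LHS]/(mten L Rh u x y) -(metric_phi_l L_finsler).
  rewrite -(raiseP L_finsler _ (mten_linear_r L_finsler Rh_tri u x)) m_o_phi.
  exact: (metric_scale_l L_finsler).
split; [split; first exact: leq_trans n4|].
  exists (fun u => t u + Ften L Rh u (eta u) (eta u) / Lslit L u ^+ 2) => u x y.
  have L0 := Lslit_neq0 L_finsler u.
  (* Everything is expressed through the values of F and g on x, y, eta, which
     are then generalized. *)
  have := mE u x y; rewrite RE !phiE.
  rewrite !(Ften_subZ_l L_finsler Rh_tri, Ften_subZ_r L_finsler Rh_tri).
  rewrite hbarE (metric_eta_eta L_finsler) -!(metric_eta_r L_finsler).
  move: (Ften L Rh u (eta u) (eta u)) (Ften L Rh u (eta u) y).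
  move: (Ften L Rh u x (eta u)) (Ften L Rh u x y) => Fxe Fxy Fee Fey.
  move: (metric L u x (eta u)) (metric L u y (eta u)) (metric L u x y).
  move: (Lslit L u) L0 (t u) => l l0 k a b g.
  (* Solve for F(x, y): an identity of rational functions is left. *)
  move=> /(canRL (subrK _)) /(canRL (subrK _)) ->.
  by field.
(* Each product of two values of hbar arises twice, whence the factor 2. *)
exists (fun u => 2 * t u) => u x y z w; rewrite RE.
have gE v v' := metric_phi L_finsler u v v'.
transitivity (hbar L u x z * (t u * hbar L u y w)
            - hbar L u y z * (t u * hbar L u x w)
            + hbar L u y w * (t u * hbar L u x z)
            - hbar L u x w * (t u * hbar L u y z)).
  by congr (_ - _); [congr (_ + _); [congr (_ - _)|]|];
     (congr (_ * _); [exact: gE|exact: mE]).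
move: (t u) (hbar L u x z) (hbar L u x w) (hbar L u y z) (hbar L u y w).
by move=> k a b c d; ring.
Qed.
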